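(* Let $T_S\sim\operatorname{Exp}(\lambda_S)$ and $T_D\sim\operatorname{Exp}(\lambda_D)$ be independent exponential random variables with rates $\lambda_S,\lambda_D>0$, and let $q_S,q_D>0$. For $H>0$ and $i\in\{S,D\}$ let $a_i(H)=\Pr(T_i\le H)$ and $\Delta C_i(H)=q_i[1-a_i(H)]$. Then: (1) $\Delta C_i(H)=q_i e^{-\lambda_i H}$ for $i\in\{S,D\}$ and every $H>0$. (2) If $q_S=q_D=q$ and $\lambda_S>\lambda_D$, then $\Delta C_D(H)>\Delta C_S(H)$ for every $H>0$. (3) More generally, for each $H>0$, $\Delta C_D(H)>\Delta C_S(H)$ if and only if $$\frac{q_D}{q_S}>e^{-(\lambda_S-\lambda_D)H}.$$ (4) If $q_S=q_D=q$ and $\lambda_S>\lambda_D$, then the expected capability moat under restriction between the faster-substituting group $S$ and the slower-substituting group $D$, namely $q\,a_S(H)-q\,a_D(H)$, equals $\Delta C_D(H)-\Delta C_S(H)$.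
   Context: $\operatorname{Exp}(\lambda)$ denotes the exponential distribution with rate $\lambda$. $T_i$ is the time at which actor class $i$ ($S$ = sophisticated adversaries, $D$ = defenders) obtains a substitute under restriction, $q_i$ is the useful capability that immediate release supplies to actor $i$, and $\Delta C_i(H)$ is the marginal empowerment of actor $i$ at horizon $H$ from immediate release relative to restriction (immediate release raises the access probability from $a_i(H)$ to $1$). The expected capability moat is the difference of expected capabilities of the two groups at horizon $H$ under restriction. *)

(* Defs.v *)
From HB Require Import structures.
From mathcomp Require Import all_boot all_order all_algebra.
From mathcomp Require Import all_classical all_reals all_analysis.

Set Implicit Arguments.
Unset Strict Implicit.
Unset Printing Implicit Defensive.

Import Order.TTheory GRing.Theory Num.Theory.
Import numFieldNormedType.Exports.

Local Open Scope classical_set_scope.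
Local Open Scope ring_scope.

Section substitution_times.
Context (d : measure_display) (Omega : measurableType d) (R : realType).
Variable P : probability Omega R.

Definition exponentially_distributed (X : {RV P >-> R}) (rate : R) : Prop :=
  forall A : set R, measurable A ->
    distribution P X A = exponential_prob rate A.

Definition independent_RVs (X Y : {RV P >-> R}) : Prop :=
  forall A B : set R, measurable A -> measurable B ->
    P (X @^-1` A `&` Y @^-1` B) = (P (X @^-1` A) * P (Y @^-1` B))%E.

(* [fine] loses nothing here: probabilities are finite. *)
Definition access_probability (X : {RV P >-> R}) (H : R) : R :=
  fine (P [set w | X w <= H]).

(* Release raises the access probability from [access_probability X H] to 1;
   access is worth [q]. *)
Definition marginal_empowerment (q : R) (X : {RV P >-> R}) (H : R) : R :=
  q * (1 - access_probability X H).

(* Under restriction an actor holds capability [q] once its substitute, obtained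
   at the random time [X], is available, and nothing before. *)
Definition restricted_capability (q : R) (X : {RV P >-> R}) (H : R) :
    Omega -> R :=
  fun w => q * \1_[set w | X w <= H] w.

Definition expected_moat (qX : R) (X : {RV P >-> R}) (qY : R)
    (Y : {RV P >-> R}) (H : R) : \bar R :=
  ('E_P[restricted_capability qX X H] - 'E_P[restricted_capability qY Y H])%E.

End substitution_times.

(* Main.v *)
Require Import Defs.
From HB Require Import structures.
From mathcomp Require Import all_boot all_order all_algebra.
From mathcomp Require Import all_classical all_reals all_analysis.

Set Implicit Arguments.
Unset Strict Implicit.
Unset Printing Implicit Defensive.

Import Order.TTheory GRing.Theory Num.Theory.
Import numFieldNormedType.Exports.

Local Open Scope classical_set_scope.
Local Open Scope ring_scope.

(** What release adds is [q] times the survival probability beyond [H], which for an exponential law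
    is [expR (- rate * H)] ([marginal_empowerment_exp]). Comparing actors thus means comparing two
    scaled exponentials: dividing gives the threshold on [qD / qS] ([ltr_pM_expR]), and for equal
    values monotonicity of [expR] decides. For the moat, the mean of an indicator is a probability
    ([expectation_restricted_capability]), and passing to complements swaps the two actors. *)

(* The density is set to 0 on the negative half-line. *)
Lemma exponential_prob_itvNyc (R : realType) (rate x : R) : 0 < x ->
  exponential_prob rate `]-oo, x] = (1 - (expR (- rate * x))%:E)%E.
Proof.
move=> x_gt0; rewrite -exponential_prob_itv0c// /exponential_prob.
(* Extended by zero to the whole line, the integrands over the ray and over the segment from 0 to
   [x] agree pointwise: for [t < 0] both vanish. *)
rewrite integral_mkcond [RHS]integral_mkcond; apply: eq_integral => t _.
rewrite !patchE !mem_setE !in_itv/=; have [//|t_lt0] := leP 0 t.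
by rewrite lt0_exponential_pdf// if_same.
Qed.

Section substitution_time.
Context (d : measure_display) (Omega : measurableType d) (R : realType).
Variables (P : probability Omega R) (X : {RV P >-> R}).

Lemma measurable_substituted (H : R) : measurable [set w | X w <= H].
Proof.
rewrite (_ : [set w | _] = X @^-1` `]-oo, H]); last first.
  by apply/seteqP; split => w; rewrite /= in_itv.
exact: measurable_funPTI.
Qed.

Lemma marginal_empowerment_exp (q rate H : R) :
  exponentially_distributed X rate -> 0 < H ->
  marginal_empowerment q X H = q * expR (- rate * H).
Proof.
move=> X_exp H_gt0; rewrite /marginal_empowerment /access_probability.
rewrite (_ : P _ = distribution P X `]-oo, H]); last first.
  by congr (P _); apply/seteqP; split => w; rewrite /= in_itv.
rewrite X_exp// exponential_prob_itvNyc// -EFinB /=.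
by congr (_ * _); rewrite opprB addrC subrK.
Qed.

Lemma expectation_restricted_capability (q H : R) : 0 <= q ->
  ('E_P[restricted_capability q X H] = (q * access_probability X H)%:E)%E.
Proof.
move=> q_ge0; have mX := measurable_substituted H.
rewrite unlock /restricted_capability.
(* The set family is constant here; the side condition, that the set be empty for a negative scalar,
   is vacuous since [0 <= q]. *)
rewrite (integralZl_indic _ (fun=> [set w | X w <= H]))//; last first.
  by move=> q_lt0; move: q_ge0; rewrite leNgt q_lt0.
rewrite integral_indic// setIT EFinM /access_probability fineK//.
exact: fin_num_measure.
Qed.

End substitution_time.

(** Divide by the positive quantities [p] and [expR (- b * H)]; the quotient of the exponentials is
    the exponential of the difference. *)
Lemma ltr_pM_expR (R : realType) (a b p q H : R) : 0 < p ->
  (p * expR (- a * H) < q * expR (- b * H)) =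
  (expR (- (a - b) * H) < q / p).
Proof.
move=> p_gt0; rewrite (_ : - (a - b) * H = - a * H - - b * H); last first.
  by rewrite -mulrBl opprB opprK addrC.
rewrite expRB ltr_pdivlMr// mulrAC ltr_pdivrMr ?expR_gt0//.
by rewrite [expR _ * p]mulrC.
Qed.

Theorem proposition2 (R : realType) (d : measure_display)
    (Omega : measurableType d) (P : probability Omega R)
    (TS TD : {RV P >-> R}) (lambdaS lambdaD qS qD : R)
    (lambdaS_gt0 : 0 < lambdaS) (lambdaD_gt0 : 0 < lambdaD)
    (qS_gt0 : 0 < qS) (qD_gt0 : 0 < qD)
    (TS_exp : exponentially_distributed TS lambdaS)
    (TD_exp : exponentially_distributed TD lambdaD)
    (TS_TD_indep : independent_RVs TS TD) :
  (forall H : R, 0 < H ->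
     marginal_empowerment qS TS H = qS * expR (- lambdaS * H) /\
     marginal_empowerment qD TD H = qD * expR (- lambdaD * H)) /\
  (forall q : R, qS = q -> qD = q -> lambdaD < lambdaS ->
     forall H : R, 0 < H ->
       marginal_empowerment qS TS H < marginal_empowerment qD TD H) /\
  (forall H : R, 0 < H ->
     (marginal_empowerment qS TS H < marginal_empowerment qD TD H <->
      expR (- (lambdaS - lambdaD) * H) < qD / qS)) /\
  (forall q : R, qS = q -> qD = q -> lambdaD < lambdaS ->
     forall H : R, 0 < H ->
       expected_moat qS TS qD TD H =
         (q * access_probability TS H - q * access_probability TD H)%:E /\
       q * access_probability TS H - q * access_probability TD H =
         marginal_empowerment qD TD H - marginal_empowerment qS TS H).
Proof.
have empS H : 0 < H -> _ := marginal_empowerment_exp qS TS_exp.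
have empD H : 0 < H -> _ := marginal_empowerment_exp qD TD_exp.
split; first by move=> H H_gt0; rewrite empS// empD.
split=> [q eqS eqD ltDS H H_gt0|].
  (* The common factor [q] cancels, being positive as equal to [qS]; then [expR] is increasing and
     [H] is positive. *)
  rewrite empS// empD// eqS eqD ltr_pM2l -?eqS// ltr_expR ltr_pM2r//.
  by rewrite ltrN2.
split=> [H H_gt0|q eqS eqD _ H _]; first by rewrite empS// empD// ltr_pM_expR.
split; last first.
  (* The terms [q * 1] of the two actors cancel. *)
  by rewrite /marginal_empowerment eqS eqD -!mulrBr opprB [in RHS]addrC subrKA.
by rewrite /expected_moat !expectation_restricted_capability ?ltW// eqS eqD -EFinB.
Qed.
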